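(* Let $q$ be a prime power, $k\ge 1$ and $n\ge 2k+1$. Let $\mathcal{L}$ be a set of affine $k$-spaces of $\mathrm{AG}(n,q)$ with $|\mathcal{L}|=x\left[{n\atop k}\right]_q$ for a positive integer $x$. Then the following are equivalent: (1) $\mathcal{L}$ is a Cameron-Liebler $k$-set of $\mathrm{AG}(n,q)$; (2) for every $k$-spread $\mathcal{S}$ of $\mathrm{AG}(n,q)$, $|\mathcal{L}\cap\mathcal{S}|=x$; (3) for every pair $\mathcal{R},\mathcal{R}'$ of conjugated switching $k$-sets of $\mathrm{AG}(n,q)$, $|\mathcal{L}\cap\mathcal{R}|=|\mathcal{L}\cap\mathcal{R}'|$. Moreover, if $k=1$, these are also equivalent to: (4) for every affine line $\ell$, the number of elements of $\mathcal{L}$ sharing no affine point with $\ell$ equals $\left(q^2\left[{n-2\atop 1}\right]_q+1\right)(x-\chi_{\mathcal{L}}(\ell))$, and through every point of $\pi_\infty$ there pass exactly $x$ lines of $\mathcal{L}$ (i.e. exactly $x$ lines of $\mathcal{L}$ whose projective closure contains that point).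
   Context: $\mathrm{AG}(n,q)$ is $\mathrm{PG}(n,q)$ with a hyperplane $\pi_\infty$ (hyperplane at infinity) removed; affine points are the points outside $\pi_\infty$, affine $k$-spaces are the $k$-dimensional projective subspaces not contained in $\pi_\infty$ (identified with their affine point sets). $\left[{a\atop b}\right]_q=\frac{(q^a-1)\cdots(q^{a-b+1}-1)}{(q^b-1)\cdots(q-1)}$. With $A_n$ the incidence matrix of affine points versus affine $k$-spaces, a set of affine $k$-spaces is a Cameron-Liebler $k$-set of $\mathrm{AG}(n,q)$ if its characteristic vector lies in the real row space $\mathrm{Im}(A_n^T)$. A partial $k$-spread is a set of affine $k$-spaces pairwise sharing no affine point; a $k$-spread is a partial $k$-spread covering all affine points. A pair of conjugated switching $k$-sets is a pair of disjoint partial $k$-spreads covering the same set of affine points. $\chi_{\mathcal{L}}(\ell)$ is $1$ if $\ell\in\mathcal{L}$ and $0$ otherwise. *)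

(* Defs.v *)
From HB Require Import structures.
From mathcomp Require Import all_boot all_order all_algebra.
From mathcomp Require Import Rstruct.
From Stdlib Require Rdefinitions.
Set Implicit Arguments. Unset Strict Implicit. Unset Printing Implicit Defensive.
Import Order.TTheory GRing.Theory Num.Theory.

(* Gaussian binomial coefficient [a b]_q (an exact integer division). *)
Definition qbinom (q a b : nat) : nat :=
  ((\prod_(i < b) (q ^ (a - i) - 1)) %/ (\prod_(i < b) (q ^ (i.+1) - 1)))%N.

Local Open Scope ring_scope.

Section AG.
Variables (F : finFieldType) (n : nat).

(* Affine points of AG(n,q) = vectors of F^n (the complement of pi_infinity).
   Affine subspaces are identified with their affine point sets. *)
Definition point := 'rV[F]_n.

Definition is_affine_space (k : nat) (S : {set point}) : Prop :=
  exists (v : point) (W : 'M[F]_(k, n)),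
    \rank W = k /\ S = [set v + u *m W | u : 'rV[F]_k].

Definition set_of_kspaces (k : nat) (L : {set {set point}}) : Prop :=
  forall S, S \in L -> is_affine_space k S.

(* Cameron-Liebler k-set: the characteristic vector of L (indexed by affine
   k-spaces) lies in the real row space of the point/k-space incidence matrix
   A_n, i.e. it is a real combination of the rows of A_n. *)
Definition cameron_liebler (k : nat) (L : {set {set point}}) : Prop :=
  exists c : point -> Rdefinitions.R,
    forall K, is_affine_space k K ->
      ((K \in L)%:R : Rdefinitions.R) = \sum_(p in K) c p.

Definition partial_spread (k : nat) (S : {set {set point}}) : Prop :=
  set_of_kspaces k S /\
  forall A B, A \in S -> B \in S -> A != B -> [disjoint A & B].

Definition spread (k : nat) (S : {set {set point}}) : Prop :=
  partial_spread k S /\ forall p : point, exists2 A, A \in S & p \in A.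

Definition conjugated_switching (k : nat) (R1 R2 : {set {set point}}) : Prop :=
  [/\ partial_spread k R1, partial_spread k R2, [disjoint R1 & R2] &
      cover R1 = cover R2].

Definition point_at_infinity (P : {set point}) : Prop :=
  exists2 d : point, d != 0 & P = [set c *: d | c : F].

(* Direction of an affine subspace: the linear subspace of differences.
   The projective closure of an affine line m contains the point at infinity P
   iff direction m = P. *)
Definition direction (S : {set point}) : {set point} :=
  [set a - b | a in S, b in S].

End AG.

(* Main.v *)
Require Import Defs.
From HB Require Import structures.
From mathcomp Require Import all_boot all_order all_algebra.
From mathcomp Require Import mxabelem ring lra zify.
From mathcomp Require Import Rstruct.
From Stdlib Require Rdefinitions.
Set Implicit Arguments. Unset Strict Implicit. Unset Printing Implicit Defensive.
Import Order.TTheory GRing.Theory Num.Theory.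

(** Let f be the characteristic function of L. Inside a (k+1)-flat U, two parallel
    classes of k-flats form conjugated switching sets, and completing each of them by
    translates outside U gives two spreads; so (2) and (3) both imply that the sum of f
    over the k-flats of U with direction W does not depend on W. For a linear form phi,
    the level sets of phi are unions of such U, and the Grassmann graph of ker phi is
    connected; hence the sum g(phi, t) of f over the k-flats of direction W in the level
    set phi = t does not depend on W <= ker phi. Summing g(phi, phi(p)) over all phi and
    over the points p of a k-flat K = v + W, the forms vanishing on W yield a positive
    multiple of f(K) plus a constant, and the others are equidistributed on K and yield
    a constant. So an affine function of sum_phi g(phi, phi(p)) gives point weights
    representing f. For k = 1, counting the lines of L through the points of a line
    shows that the degrees in L determine the weights, which is condition (4). *)

(** * Flats, parallel classes, and spreads built from them *)

Section Flats.
Variables (F : finFieldType) (n : nat).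
Implicit Types (p v : 'rV[F]_n).
Local Open Scope ring_scope.

(** The coset of the row space of [W] through [v]. No rank condition is imposed on [W], so square
    matrices can represent subspaces of every dimension by one type. *)
Definition flat m (W : 'M[F]_(m, n)) v : {set 'rV[F]_n} := [set p | (p - v <= W)%MS].

Definition cosets m (W : 'M[F]_(m, n)) (U : {set 'rV[F]_n}) := [set flat W v | v in U].

Lemma mem_flat m (W : 'M[F]_(m, n)) v p : (p \in flat W v) = (p - v <= W)%MS.
Proof. by rewrite inE. Qed.

Lemma flat_refl m (W : 'M[F]_(m, n)) v : v \in flat W v.
Proof. by rewrite mem_flat subrr sub0mx. Qed.

Lemma flat_sym m (W : 'M[F]_(m, n)) v p : (p \in flat W v) = (v \in flat W p).
Proof. by rewrite !mem_flat -opprB eqmx_opp. Qed.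

Lemma flat_eq m (W : 'M[F]_(m, n)) v p : p \in flat W v -> flat W p = flat W v.
Proof.
move=> pv; have vp: v \in flat W p by rewrite flat_sym.
move: pv vp; rewrite !mem_flat => pv vp.
apply/setP=> r; rewrite !mem_flat; apply/idP/idP => H.
  by rewrite -(subrK p r) -addrA addmx_sub.
by rewrite -(subrK v r) -addrA addmx_sub.
Qed.

Lemma flat_eqE m (W : 'M[F]_(m, n)) v p : (flat W p == flat W v) = (p \in flat W v).
Proof.
apply/eqP/idP => [<-|/flat_eq //]; exact: flat_refl.
Qed.

Lemma flat_eqmx m1 m2 (W : 'M[F]_(m1, n)) (W' : 'M[F]_(m2, n)) v :
  (W :=: W')%MS -> flat W v = flat W' v.
Proof. by move=> e; apply/setP=> p; rewrite !mem_flat e. Qed.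

Lemma flatS m1 m2 (W : 'M[F]_(m1, n)) (W' : 'M[F]_(m2, n)) v :
  (W <= W')%MS -> flat W v \subset flat W' v.
Proof.
by move=> s; apply/subsetP=> p; rewrite !mem_flat => /submx_trans; apply.
Qed.

(** A flat determines its direction: translating [v] by a row of [W] stays in the flat, so the row
    is a difference of two points of the second flat. *)
Lemma flat_submx m1 m2 (W : 'M[F]_(m1, n)) (W' : 'M[F]_(m2, n)) v v' :
  flat W v = flat W' v' -> (W <= W')%MS.
Proof.
move=> e; apply/row_subP => i; set r := row i W.
have h0 : v \in flat W' v' by rewrite -e flat_refl.
have : v + r \in flat W v by rewrite mem_flat addrC addKr row_sub.
by rewrite e -(flat_eq h0) mem_flat addrC addKr.
Qed.

Lemma card_flat m (W : 'M[F]_(m, n)) v : #|flat W v| = (#|F| ^ \rank W)%N.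
Proof.
rewrite -card_rowg -[RHS](card_imset _ (addIr v)); congr #|pred_of_set _|.
apply/setP=> p; rewrite mem_flat; apply/idP/imsetP => [h|[u]].
  by exists (p - v); rewrite ?inE ?subrK.
by rewrite inE => h ->; rewrite addrK.
Qed.

Lemma flat_imset m (W : 'M[F]_(m, n)) v : flat W v = [set v + u *m W | u : 'rV_m].
Proof.
apply/setP=> p; rewrite mem_flat; apply/submxP/imsetP => [[u e]|[u _ ->]].
  by exists u; rewrite // -e addrC subrK.
by exists u; rewrite addrC addKr.
Qed.

Lemma affine_flat k m (W : 'M[F]_(m, n)) v : \rank W = k -> is_affine_space k (flat W v).
Proof.
move=> <-; exists v, (row_base W); split; first by rewrite eq_row_base.
by rewrite -flat_imset; apply: flat_eqmx; apply: eqmx_sym; apply: eq_row_base.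
Qed.

Lemma affineP k S : is_affine_space k S <->
  exists v (W : 'M[F]_n), \rank W = k /\ S = flat W v.
Proof.
split=> [[v [W [rW ->]]]|[v [W [rW ->]]]]; last exact: affine_flat.
exists v, <<W>>%MS; rewrite -flat_imset genmxE; split=> //.
by apply: flat_eqmx; apply: eqmx_sym; apply: genmxE.
Qed.

Lemma direction_flat m (W : 'M[F]_(m, n)) v : direction (flat W v) = flat W 0.
Proof.
apply/setP=> p; apply/imset2P/idP => [[a b]|].
  rewrite mem_flat flat_sym !mem_flat => av vb ->.
  by rewrite subr0 -(subrK v a) -addrA addmx_sub.
rewrite mem_flat subr0 => h; exists (p + v) v; rewrite ?addrK ?flat_refl //.
by rewrite mem_flat addrK.
Qed.

Lemma flat_trivI m (W : 'M[F]_(m, n)) v p :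
  flat W v != flat W p -> [disjoint flat W v & flat W p].
Proof.
move=> ne; apply/pred0P=> r /=; apply: contraNF ne => /andP[rv rp].
by rewrite -(flat_eq rv) (flat_eq rp).
Qed.

Lemma cosets_partial k m (W : 'M[F]_(m, n)) U : \rank W = k -> partial_spread k (cosets W U).
Proof.
move=> rW; split=> [S /imsetP[v _ ->]|A B /imsetP[v _ ->] /imsetP[p _ ->]].
  exact: affine_flat.
exact: flat_trivI.
Qed.

Lemma cover_cosets m m' (W : 'M[F]_(m, n)) (T : 'M[F]_(m', n)) v :
  (W <= T)%MS -> cover (cosets W (flat T v)) = flat T v.
Proof.
move=> WT; apply/setP=> p; apply/bigcupP/idP => [[K /imsetP[r rv ->]]|pv].
  by rewrite -(flat_eq rv); apply: subsetP; apply: flatS.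
by exists (flat W p); rewrite ?flat_refl //; apply: imset_f.
Qed.

Lemma trivIset_spread k S : partial_spread k S -> trivIset (S : {set {set 'rV[F]_n}}).
Proof. by case=> _ h; apply/trivIsetP=> A B; apply: h. Qed.

(** The cosets of [W] partition the larger flat, and each one is met once for each of its points. *)
Lemma sum_flat (R : pzSemiRingType) m m' (W : 'M[F]_(m, n)) (T : 'M[F]_(m', n)) v
    (f : {set 'rV[F]_n} -> R) : (W <= T)%MS ->
  \sum_(p in flat T v) f (flat W p)
    = (#|F| ^ \rank W)%:R * \sum_(K in cosets W (flat T v)) f K.
Proof.
move=> WT; rewrite -[in LHS](cover_cosets v WT) big_trivIset /=; last first.
  by apply: trivIset_spread; apply: (@cosets_partial (\rank W)).
rewrite mulr_sumr; apply: eq_bigr => K /imsetP[p pv ->].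
rewrite -(card_flat W p) mulr_natl -sumr_const; apply: eq_bigr => r rp.
by rewrite (flat_eq rp).
Qed.

Lemma sum_cosets_card (R : pzSemiRingType) (L S : {set {set 'rV[F]_n}}) :
  \sum_(K in S) ((K \in L)%:R : R) = #|L :&: S|%:R.
Proof.
rewrite -sum1_card natr_sum (big_setID L) /= [X in _ + X]big1 ?addr0.
  by rewrite setIC; apply: eq_bigr => K /setIP[-> _].
by move=> K /setDP[_ /negbTE ->].
Qed.

Lemma spread_parallel k m (W : 'M[F]_(m, n)) : \rank W = k -> spread k (cosets W setT).
Proof.
move=> rW; split; first exact: cosets_partial.
by move=> p; exists (flat W p); rewrite ?flat_refl // imset_f.
Qed.

(** Since [W <= T], the flat of [T] is a union of cosets of [W]; so is its complement, and the
    translates of [W] starting outside never meet members of [R]. *)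
Lemma spread_switch k m m' (W : 'M[F]_(m, n)) (T : 'M[F]_(m', n)) v R :
  \rank W = k -> (W <= T)%MS -> partial_spread k R -> cover R = flat T v ->
  spread k (R :|: cosets W (~: flat T v)).
Proof.
move=> rW WT [R1 R2] cR.
have dis A B : A \in R -> B \in cosets W (~: flat T v) -> [disjoint A & B].
  move=> AR /imsetP[p pT ->]; apply/pred0P=> r /=; apply: contraTF pT => /andP[rA rp].
  have rT: r \in flat T v by rewrite -cR; apply/bigcupP; exists A.
  rewrite inE negbK -(flat_eq rT); apply: (subsetP (flatS r WT)).
  by rewrite flat_sym.
have [c1 c2] := cosets_partial (~: flat T v) rW.
split; first split.
- by move=> S /setUP[/R1|/c1].
- move=> A B /setUP[hA|hA] /setUP[hB|hB] AB; [exact: (R2 A B)|exact: (dis A B)| |exact: (c2 A B)].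
  by rewrite disjoint_sym dis.
- move=> p; have [pT|pT] := boolP (p \in flat T v).
    by move: (pT); rewrite -cR => /bigcupP[A AR pA]; exists A; rewrite // inE AR.
  by exists (flat W p); rewrite ?flat_refl // inE orbC imset_f ?in_setC ?pT.
Qed.

End Flats.

(** * Intermediate subspaces and connectivity of the Grassmann graph *)

Section Subspaces.
Variables (F : fieldType) (n : nat).

Lemma rank_adds_rV m (A : 'M[F]_(m, n)) (w : 'rV[F]_n) :
  \rank (A + w)%MS = \rank A + ~~ (w <= A)%MS.
Proof.
have [wA|wA] := boolP (w <= A)%MS; first by rewrite addn0 (addsmx_idPl wA).
apply/eqP; rewrite -(eqn_add2r (\rank (A :&: w)%MS)) mxrank_sum_cap -addnA eqn_add2l.
have w0 : w != 0%R by apply: contraNneq wA => ->; rewrite sub0mx.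
have := ltn_leqif (mxrank_leqif_sup (capmxSr A w)).
by rewrite sub_capmx negb_and wA /= rank_rV w0; case: (\rank (A :&: w)%MS).
Qed.

Lemma intermediate_submx m1 m2 (A : 'M[F]_(m1, n)) (B : 'M[F]_(m2, n)) r :
  (A <= B)%MS -> \rank A <= r <= \rank B ->
  exists C : 'M[F]_n, [/\ (A <= C)%MS, (C <= B)%MS & \rank C = r].
Proof.
move=> AB /andP[].
elim: r => [|r IH] Ar rB.
  by exists <<A>>%MS; rewrite !genmxE; split=> //; apply/eqP; rewrite -leqn0.
move: Ar; rewrite leq_eqVlt => /predU1P[eA|Ar].
  by exists <<A>>%MS; rewrite !genmxE.
have [C [AC CB rC]] := IH Ar (ltnW rB).
have /row_subPn[i hi] : ~~ (B <= C)%MS.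
  by apply: contraTN rB => /mxrankS; rewrite rC -leqNgt.
exists (C + row i B)%MS; split; last by rewrite rank_adds_rV hi rC addn1.
  exact: submx_trans AC (addsmxSl _ _).
by rewrite addsmx_sub CB row_sub.
Qed.

(** Subspaces of dimension [k] in a common [T] of dimension [k.+1] are adjacent. Induction on [k]
    minus the dimension of the intersection: each step moves [W] to a neighbour meeting [W'] in a
    larger space. *)
Lemma grassmann_connected (X : Type) m (N : 'M[F]_(m, n)) k (g : 'M[F]_n -> X) :
  (forall W W', (W :=: W')%MS -> g W = g W') ->
  (forall W W' T : 'M[F]_n, \rank W = k -> \rank W' = k -> \rank T = k.+1 ->
     (W <= T)%MS -> (W' <= T)%MS -> (T <= N)%MS -> g W = g W') ->
  forall W W' : 'M[F]_n, \rank W = k -> \rank W' = k ->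
    (W <= N)%MS -> (W' <= N)%MS -> g W = g W'.
Proof.
move=> geq gadj W W' rW rW' WN W'N.
have [d] := ubnP (k - \rank (W :&: W')%MS).
elim: d W rW WN => // d IH W rW WN hd.
have [W'W|W'W] := boolP (W' <= W)%MS.
  apply: geq; apply/eqmxP; rewrite W'W andbT.
  by rewrite -(geq_leqif (mxrank_leqif_sup W'W)) rW rW'.
have /row_subPn[i wW] := W'W; set w := row i W' in wW.
have wW' : (w <= W')%MS by exact: row_sub.
have capk : \rank (W :&: W')%MS < k.
  by rewrite -rW' (ltn_leqif (mxrank_leqif_sup (capmxSr W W'))) sub_capmx (negbTE W'W).
(* The neighbour is [X0 + w], with [X0] a hyperplane of [W] through the intersection and [w] in [W']
   but not in [W]; both lie in [W + w]. By [capk], [k] is positive, so [k.-1] is a true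
   predecessor. *)
have [X0 [capX XW rX]] : exists C : 'M[F]_n,
    [/\ (W :&: W' <= C)%MS, (C <= W)%MS & \rank C = k.-1].
  by apply: intermediate_submx; [exact: capmxSl|rewrite rW; lia].
have wX : ~~ (w <= X0)%MS by apply: contraNN wW => /submx_trans; apply.
have rV : \rank (X0 + w)%MS = k by rewrite rank_adds_rV wX rX; lia.
have TN : (W + w <= N)%MS by rewrite addsmx_sub WN (submx_trans wW').
have VT : (X0 + w <= W + w)%MS by exact: addsmxS.
rewrite (gadj W (X0 + w)%MS (W + w)%MS) ?addsmxSl //; last first.
  by rewrite rank_adds_rV wW rW addn1.
apply: IH => //; first exact: submx_trans VT TN.
(* The new intersection contains the old one and also [w], which the old one misses. *)
have : ((W :&: W') + w <= (X0 + w) :&: W')%MS.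
  by rewrite sub_capmx addsmxS //= addsmx_sub capmxSr.
move/mxrankS; rewrite rank_adds_rV.
have -> : ~~ (w <= W :&: W')%MS by rewrite sub_capmx negb_and wW.
by lia.
Qed.

End Subspaces.

(** * Counting matrices with independent rows *)

Section Counting.
Variable F : finFieldType.

(** A new row keeps the matrix free exactly when it avoids the row space of the earlier [k] rows,
    which has [#|F| ^ k] elements. *)
Lemma card_row_free k n :
  #|[set W : 'M[F]_(k, n) | row_free W]| = \prod_(i < k) (#|F| ^ n - #|F| ^ i).
Proof.
elim: k => [|k IH].
  rewrite big_ord0 -(cards1 (0%R : 'M[F]_(0, n))); apply: eq_card => W.
  by rewrite !inE (flatmx0 W) eqxx; apply/eqP; apply: mxrank0.
rewrite big_ord_recr /= -IH -sum_nat_const -sum1_card.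
pose join (p : 'M[F]_(k, n) * 'rV[F]_n) : 'M[F]_(1 + k, n) := col_mx p.2 p.1.
pose split (W : 'M[F]_(1 + k, n)) := (dsubmx W, usubmx W).
have joinK : cancel join split.
  by case=> A w; rewrite /split /join col_mxKu col_mxKd.
have splitK : cancel split join by move=> W; rewrite /split /join /= vsubmxK.
have rj A w : row_free (join (A, w)) = row_free A && ~~ (w <= A)%MS.
  have rk : \rank (join (A, w)) = \rank A + ~~ (w <= A)%MS.
    by rewrite -rank_adds_rV /join /= -addsmxE addsmxC.
  rewrite /row_free rk; have := rank_leq_row A.
  by case: (w <= A)%MS => /=; lia.
rewrite (reindex join) /=; last by exists split => W _; rewrite ?joinK ?splitK.
rewrite (eq_bigl (fun p =>
  (p.1 \in [set W : 'M[F]_(k, n) | row_free W]) && ~~ (p.2 <= p.1)%MS)); last first.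
  by case=> A w; rewrite !inE rj.
rewrite -(pair_big_dep (fun A => A \in [set W : 'M[F]_(k, n) | row_free W])
  (fun A w => ~~ (w <= A)%MS) (fun _ _ => 1)) /=.
apply: eq_bigr => A; rewrite inE => /eqP rA.
rewrite sum1_card -[in RHS]rA -card_rowg -[_ ^ n]mul1n.
have <- : #|'rV[F]_n| = (1 * #|F| ^ n)%N by rewrite card_mx !mul1n.
by rewrite -(cardC (rowg A)) addKn; apply: eq_card => w; rewrite !inE.
Qed.

End Counting.

(** * Recovering a function on flats from its sums over level sets of linear forms *)

Section Inversion.
Variables (F : finFieldType) (n : nat) (R : numFieldType).
Implicit Types (p v w : 'rV[F]_n) (phi : 'cV[F]_n).
Local Open Scope ring_scope.

Definition pairing p phi : F := (p *m phi) 0 0.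

Lemma pairingD p v phi : pairing (p + v) phi = pairing p phi + pairing v phi.
Proof. by rewrite /pairing mulmxDl mxE. Qed.

Lemma pairingZ a v phi : pairing (a *: v) phi = a * pairing v phi.
Proof. by rewrite /pairing -scalemxAl mxE. Qed.

Lemma pairing_eq0 v phi : (pairing v phi == 0) = (v <= kermx phi)%MS.
Proof.
apply/eqP/sub_kermxP => [h|h]; last by rewrite /pairing h mxE.
by rewrite [v *m phi]mx11_scalar -/(pairing v phi) h raddf0.
Qed.

Lemma pairing_eq v w phi : (pairing v phi == pairing w phi) = (v - w <= kermx phi)%MS.
Proof.
by rewrite -pairing_eq0 -subr_eq0 pairingD -scaleN1r pairingZ mulN1r.
Qed.

Lemma card_annihilator m (A : 'M[F]_(m, n)) :
  #|[set phi : 'cV[F]_n | (A <= kermx phi)%MS]| = (#|F| ^ (n - \rank A))%N.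
Proof.
rewrite -(mxrank_tr A) -mxrank_ker -card_rowg -(card_imset _ (@trmx_inj _ n 1)).
congr #|pred_of_set _|; apply/setP=> u; rewrite inE; apply/imsetP/sub_kermxP => [[phi]|h].
  by rewrite inE => /sub_kermxP h ->; rewrite -trmx_mul h trmx0.
exists u^T; rewrite ?trmxK // inE; apply/sub_kermxP.
by rewrite -[A]trmxK -trmx_mul h trmx0.
Qed.

(** Double counting: a level set of [phi] is a union of translates of [T], and each of its points
    [r] lies in [flat T v] for exactly [#|F| ^ \rank T] base points [v]. *)
Lemma sum_flat_level m (T : 'M[F]_(m, n)) phi t (f : 'rV[F]_n -> R) :
  (T <= kermx phi)%MS ->
  \sum_(v | pairing v phi == t) \sum_(r in flat T v) f r
    = (#|F| ^ \rank T)%:R * \sum_(r | pairing r phi == t) f r.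
Proof.
move=> Tphi.
rewrite (exchange_big_dep (fun r => pairing r phi == t)) /=; last first.
  move=> v r /eqP <-; rewrite mem_flat => /submx_trans h.
  by rewrite pairing_eq h.
rewrite mulr_sumr; apply: eq_bigr => r /eqP rt.
rewrite -(card_flat T r) mulr_natl -sumr_const; apply: eq_bigl => v.
rewrite flat_sym andb_idl // mem_flat => /submx_trans h.
by rewrite -rt pairing_eq h.
Qed.

(** Some row [w] of [W] is not killed by [phi]. Translation by [a *: w] permutes the flat, and as
    [a] varies the value of [phi] at a fixed point runs through all of [F]; averaging over [a] gives
    the identity. *)
Lemma sum_flat_equidistributed m (W : 'M[F]_(m, n)) v phi (h : F -> R) :
  ~~ (W <= kermx phi)%MS ->
  #|F|%:R * \sum_(p in flat W v) h (pairing p phi)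
    = (#|F| ^ \rank W)%:R * \sum_t h t.
Proof.
case/row_subPn=> i; set w := row i W; rewrite -pairing_eq0 => w0.
have shift a : \sum_(p in flat W v) h (pairing p phi) =
               \sum_(p in flat W v) h (pairing p phi + a * pairing w phi).
  rewrite (reindex_inj (addIr (a *: w))) /=; apply: eq_big => [p|p _].
    rewrite -!flat_eqE; congr (_ == _); apply: flat_eq.
    by rewrite mem_flat addrC addKr scalemx_sub ?row_sub.
  by rewrite pairingD pairingZ.
rewrite mulr_natl -sumr_const (eq_bigr _ (fun a _ => shift a)) exchange_big /=.
rewrite mulr_natl -(card_flat W v) -sumr_const; apply: eq_bigr => p _.
rewrite [RHS](reindex (fun a => pairing p phi + a * pairing w phi)) //=.
exists (fun t => (t - pairing p phi) / pairing w phi) => t _.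
  by rewrite addrC addKr mulfK.
by rewrite mulfVK // addrC subrK.
Qed.

Variables (k : nat) (f : {set 'rV[F]_n} -> R).
Hypothesis kn : (k < n)%N.
Hypothesis local_f : forall (W W' T : 'M[F]_n) v,
  \rank W = k -> \rank W' = k -> \rank T = k.+1 -> (W <= T)%MS -> (W' <= T)%MS ->
  \sum_(p in flat T v) f (flat W p) = \sum_(p in flat T v) f (flat W' p).

(** By connectivity inside [kermx phi] it suffices to treat adjacent directions in a common [T]. The
    level set then splits into translates of [T], on each of which [local_f] applies. *)
Lemma level_sum_indep phi t (W W' : 'M[F]_n) : \rank W = k -> \rank W' = k ->
  (W <= kermx phi)%MS -> (W' <= kermx phi)%MS ->
  \sum_(v | pairing v phi == t) f (flat W v) = \sum_(v | pairing v phi == t) f (flat W' v).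
Proof.
move: W W'; apply: (@grassmann_connected F n R n (kermx phi) k
  (fun W => \sum_(v | pairing v phi == t) f (flat W v))).
  by move=> W W' e; apply: eq_bigr => v _; rewrite (flat_eqmx v e).
move=> W W' T rW rW' rT WT W'T Tphi.
have q0 : (#|F| ^ \rank T)%:R != 0 :> R.
  by rewrite pnatr_eq0 expn_eq0 negb_and -lt0n (ltnW (card_finNzRing_gt1 F)).
apply: (mulfI q0); rewrite -!sum_flat_level //.
by apply: eq_bigr => v _; apply: local_f.
Qed.

(** An inversion formula: the sum over all forms [phi] of the level sums at [p], summed over the
    points [p] of a flat, is an affine function of the value of [f] there, with nonzero slope. *)
Lemma point_weights : exists c : 'rV[F]_n -> R, forall (W : 'M[F]_n) v, \rank W = k ->
  f (flat W v) = \sum_(p in flat W v) c p.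
Proof.
have exW phi : exists W : 'M[F]_n, (\rank W = k) /\ (W <= kermx phi)%MS.
  have [|W [_ h1 h2]] := @intermediate_submx F n n n 0 (kermx phi) k (sub0mx _ _).
    rewrite mxrank0 mxrank_ker /=; have := rank_leq_col phi; lia.
  by exists W.
have [Wsel Wsel_spec] := fin_all_exists exW.
pose g phi t := \sum_(v | pairing v phi == t) f (flat (Wsel phi) v).
(* The zero form has the whole space as its level set at 0, so this total is the same for every
   direction of dimension [k]. *)
pose S := \sum_v f (flat (Wsel 0) v).
have SE (W : 'M[F]_n) : \rank W = k -> \sum_v f (flat W v) = S.
  move=> rW; have [r0 _] := Wsel_spec 0.
  have k0 m (A : 'M[F]_(m, n)) : (A <= kermx (0 : 'cV[F]_n))%MS.
    by apply/sub_kermxP; rewrite mulmx0.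
  have := level_sum_indep 0 rW r0 (k0 _ _) (k0 _ _).
  by under eq_bigl do rewrite pairing_eq0 k0; under [in RHS]eq_bigl do rewrite pairing_eq0 k0.
have gE (W : 'M[F]_n) phi v : \rank W = k -> (W <= kermx phi)%MS -> 
    g phi (pairing v phi) = \sum_(r | (r - v <= kermx phi)%MS) f (flat W r).
  move=> rW Wphi; have [r0 k0] := Wsel_spec phi.
  rewrite /g (level_sum_indep _ r0 rW) //.
  by apply: eq_bigl => r; rewrite pairing_eq.
have gS phi : \sum_t g phi t = S.
  have [r0 _] := Wsel_spec phi.
  by rewrite -(SE _ r0) [RHS](partition_big (pairing^~ phi) xpredT).
pose q : R := #|F|%:R.
pose Q m : R := (#|F| ^ m)%:R.
(* The first summand comes from forms vanishing on [W], paired with points off the flat; the second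
   from the forms not vanishing on [W]. *)
pose C := Q k.+1 * Q (n - k.+1)%N + Q k * (#|{: 'cV[F]_n}|%:R - Q (n - k)%N).
have key (W : 'M[F]_n) v : \rank W = k ->
    q * \sum_(p in flat W v) \sum_phi g phi (pairing p phi)
     = Q k.+1 * Q k * (Q (n - k)%N - Q (n - k.+1)%N) * f (flat W v) + C * S.
  move=> rW; rewrite exchange_big mulr_sumr (bigID (fun phi => (W <= kermx phi)%MS)) /=.
  have -> : \sum_(phi : 'cV[F]_n | ~~ (W <= kermx phi)%MS)
      q * \sum_(p in flat W v) g phi (pairing p phi) = 
      Q k * (#|{: 'cV[F]_n}|%:R - Q (n - k)%N) * S.
    rewrite (eq_bigr (fun=> Q k * S)); last first.
      by move=> phi Wphi; rewrite sum_flat_equidistributed // gS rW.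
    rewrite sumr_const -[LHS]mulr_natl; set N := #|_|%:R.
    suff : N = #|{: 'cV[F]_n}|%:R - Q (n - k)%N by move->; rewrite mulrCA mulrA.
    rewrite /N /Q -rW -card_annihilator -(cardC [set phi : 'cV[F]_n | (W <= kermx phi)%MS]).
    by rewrite natrD addrAC subrr add0r; congr _%:R; apply: eq_card => phi; rewrite !inE.
  have -> : \sum_(phi | (W <= kermx phi)%MS) q * \sum_(p in flat W v) g phi (pairing p phi)
     = Q k.+1 * \sum_(r : 'rV[F]_n) Q (n - k - ~~ ((r - v)%R <= W)%MS)%N * f (flat W r).
    transitivity (\sum_(phi : 'cV[F]_n | (W <= kermx phi)%MS) 
       Q k.+1 * \sum_(r | (r - v <= kermx phi)%MS) f (flat W r)).
      apply: eq_bigr => phi Wphi; rewrite -(gE _ _ _ rW Wphi).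
      rewrite (eq_bigr (fun=> g phi (pairing v phi))); last first.
        move=> p; rewrite mem_flat => /submx_trans/(_ Wphi).
        by rewrite -pairing_eq => /eqP ->.
      rewrite sumr_const card_flat rW -mulr_natl mulrA; congr (_ * _).
      by rewrite /q /Q expnS natrM.
    rewrite -mulr_sumr; congr (_ * _).
    (* For fixed [r], the forms counted are those killing both [W] and [r - v]: the annihilator
       loses one dimension exactly when [r] lies off the flat. *)
    rewrite (exchange_big_dep xpredT) //=; apply: eq_bigr => r _.
    rewrite sumr_const -[LHS]mulr_natl; congr (_ * _).
    rewrite /Q -subnDA -rW -rank_adds_rV -card_annihilator; congr _%:R.
    by apply: eq_card => phi; rewrite !inE addsmx_sub.
  rewrite (bigID (fun r => r \in flat W v)) /=.
  have -> : \sum_(r | r \in flat W v) Q (n - k - ~~ ((r - v)%R <= W)%MS)%N * f (flat W r)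
     = Q k * Q (n - k)%N * f (flat W v).
    rewrite (eq_bigr (fun=> Q (n - k)%N * f (flat W v))).
      by rewrite sumr_const card_flat rW -mulr_natl mulrA.
    by move=> r rv; rewrite (flat_eq rv) -mem_flat rv subn0.
  have -> : \sum_(r | r \notin flat W v) Q (n - k - ~~ ((r - v)%R <= W)%MS)%N * f (flat W r)
     = Q (n - k.+1)%N * (S - Q k * f (flat W v)).
    rewrite (eq_bigr (fun r => Q (n - k.+1)%N * f (flat W r))).
      rewrite -mulr_sumr -(SE _ rW) [X in X - _](bigID (fun r => r \in flat W v)) /=.
      rewrite [X in (X + _ - _)](eq_bigr (fun=> f (flat W v))).
        by rewrite sumr_const card_flat rW -mulr_natl -/(Q k) [_ * f _ + _]addrC addrK.
      by move=> r /flat_eq ->.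
    by move=> r rv; rewrite -mem_flat rv -subnDA addn1.
  by rewrite /C; ring.
have q1 : (1 < #|F|)%N := card_finNzRing_gt1 F.
have Qn0 m : Q m != 0 by rewrite /Q pnatr_eq0 expn_eq0 negb_and -lt0n (ltn_trans _ q1).
have q0 : q != 0 by rewrite pnatr_eq0 -lt0n (ltn_trans _ q1).
pose D := Q k.+1 * Q k * (Q (n - k)%N - Q (n - k.+1)%N).
(* As [k < n], the exponents [n - k] and [n - k.+1] differ, so the two powers of [#|F|] do too. *)
have D0 : D != 0.
  rewrite !mulf_neq0 // subr_eq0 /Q eqr_nat eqn_exp2l //; lia.
(* This solves [key] for [f]; the constant term is shared equally among the [Q k] points of a
   flat. *)
exists (fun p => q / D * (\sum_phi g phi (pairing p phi)) - C * S / D / Q k) => W v rW.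
rewrite sumrB -mulr_sumr sumr_const card_flat rW -mulr_natl -/(Q k).
have -> : \sum_(p in flat W v) \sum_phi g phi (pairing p phi) = (D * f (flat W v) + C * S) / q.
  by rewrite -key // mulrC mulKf.
by field; rewrite q0 D0 Qn0.
Qed.

End Inversion.

(** * Gaussian binomials as quotients of numbers of frames *)

Section Frames.
Variables (F : finFieldType) (k n : nat).
Local Notation frames m := [set W : 'M[F]_(k, m) | row_free W].
Local Notation q := #|F|.

(** The ordered bases of the row space of [W0] are the products [A *m W0] with [A] invertible. *)
Lemma card_frames_of (W0 : 'M[F]_(k, n)) : row_free W0 ->
  #|[set W in frames n | (W == W0)%MS]| = #|frames k|.
Proof.
move=> W0f; rewrite -(card_imset _ (row_free_inj W0f)).
congr #|pred_of_set _|; apply/setP=> W; rewrite !inE; apply/andP/imsetP => [[Wf]|[A]].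
  case/andP=> /submxP[A WA] _; exists A => //.
  by rewrite inE; move: Wf; rewrite WA /row_free mxrankMfree.
rewrite inE => Af ->; split; first by rewrite /row_free mxrankMfree.
rewrite -(geq_leqif (mxrank_leqif_eq (submxMl _ _))) mxrankMfree //.
by rewrite (eqP Af) rank_leq_row.
Qed.

(** Grouping frames by row space gives classes of equal size. This makes the integer division in
    [qbinom] exact. *)
Lemma dvdn_frames : #|frames k| %| #|frames n|.
Proof.
rewrite -[X in _ %| X]sum1_card (partition_big_imset (fun W : 'M[F]_(k, n) => <<W>>%MS)) /=.
apply: dvdn_sum => X /imsetP[W0]; rewrite inE => W0f ->.
apply/dvdnP; exists 1; rewrite mul1n -(card_frames_of W0f) sum1_card.
by apply: eq_card => W; rewrite [LHS]unfold_in /= !inE; congr (_ && _); apply/eqP/idP => /genmxP.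
Qed.

Lemma card_frames_gt0 : k <= n -> 0 < #|frames n|.
Proof.
move=> kn; rewrite card_row_free prodn_gt0 // => i.
by rewrite subn_gt0 ltn_exp2l ?card_finNzRing_gt1 // (leq_trans (ltn_ord i)).
Qed.

Lemma prod_expn_sub m : k <= m ->
  \prod_(i < k) (q ^ m - q ^ i) = \prod_(i < k) q ^ i * \prod_(i < k) (q ^ (m - i) - 1).
Proof.
move=> km; rewrite -big_split /=; apply: eq_bigr => i _.
by rewrite mulnBr muln1 -expnD subnKC // (leq_trans _ km) // ltnW.
Qed.

Lemma qbinom_frames : k <= n -> qbinom q n k * #|frames k| = #|frames n|.
Proof.
move=> kn; have := dvdn_frames.
have q0 : 0 < \prod_(i < k) q ^ i.
  by rewrite prodn_gt0 // => i; rewrite expn_gt0 (ltnW (card_finNzRing_gt1 F)).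
rewrite /qbinom -(divnMl q0) -prod_expn_sub // -card_row_free.
suff -> : \prod_(i < k) q ^ i * \prod_(i < k) (q ^ i.+1 - 1) = #|frames k| by exact: divnK.
rewrite card_row_free prod_expn_sub //; congr (_ * _).
(* The denominator of [qbinom] lists its factors in the opposite order. *)
by rewrite [RHS](reindex_inj rev_ord_inj); apply: eq_bigr => i _; rewrite subKn.
Qed.

Lemma qbinom_gt0 : k <= n -> 0 < qbinom q n k.
Proof.
by move=> kn; have := card_frames_gt0 kn; rewrite -qbinom_frames // muln_gt0 => /andP[].
Qed.

(** Each member of [L] arises once for each ordered basis of its direction and each of its points as
    base point. *)
Lemma sum_frames_flat (L : {set {set 'rV[F]_n}}) : set_of_kspaces k L ->
  \sum_(W in frames n) \sum_v (flat W v \in L) = #|L| * (#|frames k| * q ^ k).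
Proof.
move=> hL; rewrite -sum_nat_const.
have inL K : (K \in L : nat) = \sum_(K' in L) (K == K').
  have [KL|KL] := boolP (K \in L); last first.
    by rewrite big1 // => K' K'L; case: eqP KL => // ->; rewrite K'L.
  rewrite (bigD1 K) //= eqxx big1 // => K' /andP[_ /negbTE].
  by rewrite eq_sym => ->.
under eq_bigr => W _ do (under eq_bigr => v _ do rewrite inL; rewrite exchange_big /=).
rewrite exchange_big /=; apply: eq_bigr => K /hL [v0 [W0 [rW0 ->]]].
have W0f : row_free W0 by rewrite /row_free rW0.
rewrite -(card_frames_of W0f) -sum_nat_const -flat_imset.
rewrite [RHS](eq_bigl (fun W => (W \in frames n) && (W == W0)%MS)); last by move=> W; rewrite !inE.
rewrite [RHS]big_mkcondr /=; apply: eq_bigr => W _.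
case: ifPn => [/eqmxP e|ne].
  rewrite -[in RHS]rW0 -(card_flat W0 v0) -sum1_card [RHS]big_mkcond /=.
  by apply: eq_bigr => v _; rewrite (flat_eqmx v e) flat_eqE; case: (_ \in _).
apply: big1 => v _; case: eqP => // e; case/negP: ne.
by rewrite (flat_submx e) (flat_submx (esym e)).
Qed.

End Frames.

(** * Equivalence with the spread and switching conditions *)

Section Parallel.
Variables (F : finFieldType) (n k : nat).
Local Open Scope ring_scope.

Lemma sum_all_flat (R : pzSemiRingType) m (W : 'M[F]_(m, n)) (f : {set 'rV[F]_n} -> R) :
  \sum_p f (flat W p) = (#|F| ^ \rank W)%:R * \sum_(K in cosets W setT) f K.
Proof.
have T1 : flat (1%:M : 'M[F]_n) 0 = setT.
  by apply/setP=> p; rewrite mem_flat submx1 inE.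
by rewrite -T1 -sum_flat ?submx1 // T1; apply: eq_bigl => p; rewrite inE.
Qed.

(** Every [k]-space lies in the parallel class of its own direction, so summing the constant [y]
    over all frames counts [L] with a known multiplicity. *)
Lemma card_of_parallel_counts (L : {set {set 'rV[F]_n}}) y : (k <= n)%N ->
  set_of_kspaces k L ->
  (forall W : 'M[F]_(k, n), \rank W = k -> #|L :&: cosets W setT| = y) ->
  #|L| = (y * qbinom #|F| n k)%N.
Proof.
move=> kn hL hy; have := sum_frames_flat hL.
rewrite (eq_bigr (fun=> (#|F| ^ k * y)%N)) => [|W]; last first.
  rewrite inE => /eqP rW.
  rewrite -(hy W rW); have := sum_all_flat W (fun K => (K \in L : nat)).
  rewrite rW natn => ->; congr (_ * _)%N.
  have := sum_cosets_card nat L (cosets W setT); rewrite natn => <-.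
  by apply: eq_bigr => K _; rewrite natn.
rewrite sum_nat_const -qbinom_frames //.
have GQ : (0 < #|[set W : 'M[F]_(k, k) | row_free W]| * #|F| ^ k)%N.
  by rewrite muln_gt0 card_frames_gt0 // expn_gt0 (ltnW (card_finNzRing_gt1 F)).
move=> e; apply/eqP; rewrite -(eqn_pmul2r GQ) -e; apply/eqP; ring.
Qed.

Lemma sum_partial_spread (R : pzSemiRingType) S (c : 'rV[F]_n -> R) : partial_spread k S ->
  \sum_(K in S) \sum_(p in K) c p = \sum_(p in cover S) c p.
Proof. by move=> pS; rewrite big_trivIset //=; apply: trivIset_spread pS. Qed.

(** With point weights, the intersection number depends only on the set of covered points. *)
Lemma weights_partial_spread (R : pzSemiRingType) (L S : {set {set 'rV[F]_n}}) (c : 'rV[F]_n -> R) :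
  (forall K, is_affine_space k K -> (K \in L)%:R = \sum_(p in K) c p) ->
  partial_spread k S -> #|L :&: S|%:R = \sum_(p in cover S) c p.
Proof.
move=> hc pS; rewrite -sum_cosets_card -sum_partial_spread //.
by apply: eq_bigr => K KS; apply: hc; apply: pS.1.
Qed.

Lemma cover_spread S : spread k S -> cover S = [set: 'rV[F]_n].
Proof.
case=> _ cS; apply/setP=> p; rewrite inE; apply/bigcupP.
by have [A AS pA] := cS p; exists A.
Qed.

Lemma card_spread_switch m m' (W : 'M[F]_(m, n)) (T : 'M[F]_(m', n)) v
    (L R : {set {set 'rV[F]_n}}) : cover R = flat T v ->
  #|L :&: (R :|: cosets W (~: flat T v))|
    = (#|L :&: R| + #|L :&: cosets W (~: flat T v)|)%N.
Proof.
move=> cR; rewrite setIUr cardsU.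
suff -> : L :&: R :&: (L :&: cosets W (~: flat T v)) = set0 by rewrite cards0 subn0.
apply/setP=> K; rewrite in_set0; apply/negP => /setIP[/setIP[_ KR] /setIP[_]].
case/imsetP=> p; rewrite in_setC => /negP pT eK; apply: pT; rewrite -cR.
by apply/bigcupP; exists K; rewrite // eK flat_refl.
Qed.

(** Equal intersection with two parallel classes of one flat is the local condition of
    [point_weights]; equal directions give it trivially. *)
Lemma cameron_liebler_of_switching (L : {set {set 'rV[F]_n}}) : (k < n)%N ->
  (forall (W W' T : 'M[F]_n) v,
     \rank W = k -> \rank W' = k -> (W <= T)%MS -> (W' <= T)%MS -> ~ (W :=: W')%MS ->
     #|L :&: cosets W (flat T v)| = #|L :&: cosets W' (flat T v)|) ->
  cameron_liebler k L.
Proof.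
move=> kn hL.
have [|c hc] := @point_weights F n _ k (fun K => (K \in L)%:R : Rdefinitions.R) kn.
  move=> W W' T v rW rW' _ WT W'T.
  have [/eqmxP e|/eqmxP ne] := boolP (W == W')%MS.
    by apply: eq_bigr => p _; rewrite (flat_eqmx p e).
  pose chi K : Rdefinitions.R := (K \in L)%:R.
  rewrite (sum_flat v chi WT) (sum_flat v chi W'T) !sum_cosets_card rW rW'.
  by rewrite (hL W W').
by exists c => K /affineP[v [W [rW ->]]]; apply: hc.
Qed.

Lemma disjoint_cosets m1 m2 (W : 'M[F]_(m1, n)) (W' : 'M[F]_(m2, n)) U U' :
  ~ (W :=: W')%MS -> [disjoint cosets W U & cosets W' U'].
Proof.
move=> ne; apply/pred0P => K /=; apply/negP => /andP[/imsetP[v _ ->] /imsetP[v' _ e]].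
by apply: ne; apply/eqmxP; rewrite (flat_submx e) (flat_submx (esym e)).
Qed.

Lemma cameron_liebler_conjugated (L : {set {set 'rV[F]_n}}) : (k < n)%N ->
  cameron_liebler k L <->
  forall R1 R2, conjugated_switching k R1 R2 -> #|L :&: R1| = #|L :&: R2|.
Proof.
move=> kn; split=> [[c hc] R1 R2 [p1 p2 _ e]|h].
  apply/eqP; rewrite -(eqr_nat Rdefinitions.R).
  by rewrite !(weights_partial_spread hc) // e.
apply: cameron_liebler_of_switching => // W W' T v rW rW' WT W'T ne.
apply: h; split; [exact: cosets_partial|exact: cosets_partial|exact: disjoint_cosets|].
by rewrite !cover_cosets.
Qed.

(** Forward, all spreads cover the same points, so they meet [L] equally often; parallel classes and
    the size of [L] identify the common number as [x]. *)
Lemma cameron_liebler_spread (L : {set {set 'rV[F]_n}}) x : (k < n)%N ->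
  set_of_kspaces k L -> #|L| = (x * qbinom #|F| n k)%N ->
  cameron_liebler k L <-> forall S, spread k S -> #|L :&: S| = x.
Proof.
move=> kn kL cL; split=> [[c hc]|h].
  have eqS S S' : spread k S -> spread k S' -> #|L :&: S| = #|L :&: S'|.
    move=> hS hS'; apply/eqP; rewrite -(eqr_nat Rdefinitions.R).
    rewrite !(weights_partial_spread hc) ?cover_spread //; [exact: hS'.1|exact: hS.1].
  move=> S hS; apply/eqP.
  rewrite -(eqn_pmul2r (qbinom_gt0 F (ltnW kn))) -cL; apply/eqP/esym.
  apply: card_of_parallel_counts (ltnW kn) kL _ => W rW.
  by apply: eqS => //; apply: spread_parallel.
apply: cameron_liebler_of_switching => // W W' T v rW rW' WT W'T _.
(* Both classes in the flat are completed by the same translates of [W] outside it, so the outer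
   contribution cancels. *)
have hs (V : 'M[F]_n) : \rank V = k -> (V <= T)%MS ->
    (#|L :&: cosets V (flat T v)| + #|L :&: cosets W (~: flat T v)|)%N = x.
  move=> rV VT; have cV := cover_cosets v VT.
  rewrite -card_spread_switch //; apply/h/spread_switch => //.
  exact: cosets_partial.
by apply/eqP; rewrite -(eqn_add2r #|L :&: cosets W (~: flat T v)|) !hs.
Qed.

End Parallel.

(** * The case of lines: point degrees and weights *)

Section Lines.
Variables (F : finFieldType) (n : nat).
Local Notation q := #|F|.
Implicit Types (l m : {set 'rV[F]_n}) (p r z : 'rV[F]_n) (L : {set {set 'rV[F]_n}}).

Definition line p r := flat (r - p)%R p.

Lemma line_affine p r : r != p -> is_affine_space 1 (line p r).
Proof. by move=> rp; apply: affine_flat; rewrite rank_rV subr_eq0 rp. Qed.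

Lemma lineE l p r : is_affine_space 1 l -> p \in l -> r \in l -> r != p -> l = line p r.
Proof.
case/affineP=> v [W [rW ->]] pl rl rp; rewrite /line -(flat_eq pl).
apply: flat_eqmx; apply/eqmxP; rewrite andbC.
have s : ((r - p)%R <= W)%MS by rewrite -mem_flat (flat_eq pl).
rewrite s /= -(geq_leqif (mxrank_leqif_sup s)) rW rank_rV subr_eq0 rp //.
Qed.

Lemma left_line p r : p \in line p r.
Proof. exact: flat_refl. Qed.

Lemma right_line p r : r \in line p r.
Proof. by rewrite mem_flat. Qed.

Lemma card_affine k l : is_affine_space k l -> #|l| = q ^ k.
Proof. by case/affineP=> v [W [<- ->]]; rewrite card_flat. Qed.

Lemma card_punctured_line l p : is_affine_space 1 l -> p \in l ->
  \sum_(r in l | r != p) 1 = q - 1.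
Proof.
move=> al pl; have := card_affine al; rewrite expn1 => <-.
rewrite sum1_card (cardD1 p l) pl addKn.
by apply: eq_card => r; rewrite [LHS]unfold_in /= !inE andbC.
Qed.

Definition degree L p := #|[set m in L | p \in m]|.

(** A line of [L] other than [l] contributes 1 to the left side, by meeting [l] in one point or by
    being disjoint from it; [l] itself would contribute [q]. *)
Lemma sum_degree_line L l : set_of_kspaces 1 L -> is_affine_space 1 l ->
  \sum_(p in l) degree L p + #|[set m in L | [disjoint m & l]]|
    = #|L| + (q - 1) * (l \in L).
Proof.
move=> hL hl.
have -> : \sum_(p in l) degree L p = \sum_(m in L) #|m :&: l|.
  transitivity (\sum_(p in l) \sum_(m in L | p \in m) 1).
    by apply: eq_bigr => p _; rewrite sum1_card /degree; apply: eq_card => m; rewrite inE.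
  rewrite (exchange_big_dep (mem L)) /=; last by move=> p m _ /andP[].
  apply: eq_bigr => m mL; rewrite sum1_card; apply: eq_card => p.
  by rewrite [LHS]unfold_in inE /= mL andbC.
have -> : #|[set m in L | [disjoint m & l]]| = \sum_(m in L) [disjoint m & l].
  rewrite -sum1_card big_mkcond [RHS]big_mkcond; apply: eq_bigr => m _.
  by rewrite inE; case: (m \in L); case: [disjoint m & l].
have -> : (l \in L : nat) = \sum_(m in L) (m == l).
  have [lL|lL] := boolP (l \in L).
    rewrite (bigD1 l) //= eqxx big1 // => m /andP[_ /negbTE] -> //.
  by rewrite big1 // => m mL; case: eqP lL => // <-; rewrite mL.
rewrite -big_split -sum1_card big_distrr -big_split /=; apply: eq_bigr => m mL.
have [->|ml] := eqVneq m l.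
  rewrite setIid (card_affine hl) expn1 -setI_eq0 setIid.
  have -> : (l == set0) = false.
    by rewrite -cards_eq0 (card_affine hl) expn_eq0 -leqn0 leqNgt (ltnW (card_finNzRing_gt1 F)).
  by rewrite addn0 muln1 subnKC // (ltnW (card_finNzRing_gt1 F)).
rewrite muln0 addn0 -setI_eq0 -cards_eq0.
suff : #|m :&: l| <= 1 by case: #|_| => [|[]].
apply/card_le1_eqP => p r /setIP[pm pl] /setIP[rm rl].
apply/eqP; apply: contraNT ml => rp.
by rewrite (lineE (hL _ mL) pm rm) // -(lineE hl pl rl).
Qed.

Lemma sum_lines_through L p : set_of_kspaces 1 L ->
  \sum_(r | r != p) (line p r \in L) = (q - 1) * degree L p.
Proof.
move=> hL.
transitivity (\sum_(r | r != p) \sum_(m in L | p \in m) (r \in m)).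
  apply: eq_bigr => r rp; have [lL|lL] := boolP (line p r \in L).
    rewrite (bigD1 (line p r)) ?lL ?left_line //= right_line big1 //.
    move=> m /andP[/andP[mL pm] ne]; apply/eqP; rewrite eqb0; apply: contraNN ne => rm.
    by rewrite (lineE (hL _ mL) pm rm).
  rewrite big1 // => m /andP[mL pm]; apply/eqP; rewrite eqb0; apply: contraNN lL => rm.
  by rewrite -(lineE (hL _ mL) pm rm).
rewrite exchange_big /= /degree -sum1_card big_distrr /=.
rewrite [RHS](eq_bigl (fun m => (m \in L) && (p \in m))); last by move=> m; rewrite inE.
apply: eq_bigr => m /andP[mL pm]; rewrite muln1 -(card_punctured_line (hL _ mL) pm).
by rewrite [RHS](eq_bigl (fun r => (r != p) && (r \in m))) ?big_mkcondr // => r; rewrite andbC.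
Qed.

Lemma mem_line_sym p r z : r != p -> z != p -> (z \in line p r) = (r \in line p z).
Proof.
move=> rp zp; apply/idP/idP => h.
  by rewrite -(lineE (line_affine rp) (left_line _ _) h zp) right_line.
by rewrite -(lineE (line_affine zp) (left_line _ _) h rp) right_line.
Qed.

Local Open Scope ring_scope.

(** Sum the weights of [line p r] over all [r != p]: [c p] occurs [q ^ n - 1] times, and every other
    [c z] occurs [q - 1] times, once for each [r != p] on the line through [p] and [z]. *)
Lemma weighted_degree (R : numDomainType) L p (c : 'rV[F]_n -> R) : set_of_kspaces 1 L ->
  (forall K, is_affine_space 1 K -> (K \in L)%:R = \sum_(r in K) c r) ->
  (q%:R - 1) * (degree L p)%:R = (q%:R ^+ n - q%:R) * c p + (q%:R - 1) * \sum_r c r.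
Proof.
move=> hL hc.
have q1 : (q - 1)%:R = q%:R - 1 :> R by rewrite natrB // ltnW // card_finNzRing_gt1.
have -> : (q%:R - 1) * (degree L p)%:R = \sum_(r | r != p) (line p r \in L)%:R :> R.
  by rewrite -q1 -natrM -sum_lines_through // natr_sum.
rewrite (eq_bigr (fun r => c p + \sum_(z | z != p) (z \in line p r)%:R * c z)); last first.
  move=> r rp; rewrite (hc _ (line_affine rp)) (bigD1 p) ?left_line //=; congr (_ + _).
  rewrite big_mkcondl /=; apply: eq_bigr => z _.
  by case: (z \in _); rewrite ?mul1r ?mul0r.
rewrite big_split /= sumr_const exchange_big /=.
have -> : \sum_(z | z != p) \sum_(r | r != p) (z \in line p r)%:R * c z
    = (q%:R - 1) * (\sum_r c r - c p).
  rewrite [X in _ * (X - _)](bigD1 p) //= [c p + _]addrC addrK mulr_sumr.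
  apply: eq_bigr => z zp; rewrite -mulr_suml; congr (_ * _).
  rewrite -q1 -(card_punctured_line (line_affine zp) (left_line _ _)) natr_sum.
  rewrite [RHS]big_mkcondl /=; apply: eq_bigr => r rp.
  by rewrite mem_line_sym //; case: (r \in _).
have -> : #|[pred r | r != p]| = (q ^ n - 1)%N.
  have -> : (q ^ n = #|{: 'rV[F]_n}|)%N by rewrite card_mx mul1n.
  by rewrite [in RHS](cardD1 p) inE addKn; apply: eq_card => r; rewrite !inE andbT.
rewrite -[c p *+ _]mulr_natr natrB ?expn_gt0 ?(ltnW (card_finNzRing_gt1 F)) // natrX; ring.
Qed.

Lemma qbinom1 (m : nat) : (0 < m)%N -> ((q - 1) * qbinom q m 1 = q ^ m - 1)%N.
Proof.
move=> m0; have := qbinom_frames F m0; rewrite !card_row_free !big_ord1 expn1 => <-.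
by rewrite mulnC.
Qed.

Lemma cameron_liebler_lines L x : (2 < n)%N -> (0 < x)%N ->
  set_of_kspaces 1 L -> #|L| = (x * qbinom q n 1)%N ->
  cameron_liebler 1 L <->
   ((forall l, is_affine_space 1 l ->
         #|[set m in L | [disjoint m & l]]|
           = ((q ^ 2 * qbinom q (n - 2) 1 + 1) * (x - (l \in L)))%N)
      /\ (forall P, point_at_infinity P ->
            #|[set m in L | direction m == P]| = x)).
Proof.
move=> n2 x0 hL cL.
have q1 := card_finNzRing_gt1 F.
pose Q := q%:R : Rdefinitions.R.
have Q1 : Q - 1 != 0 by rewrite /Q subr_eq0 pnatr_eq1 gtn_eqF.
have q_1 : (q - 1)%:R = Q - 1 by rewrite natrB // ltnW.
have qb (m : nat) : (0 < m)%N -> (Q - 1) * (qbinom q m 1)%:R = Q ^+ m - 1.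
  move=> m0; rewrite -q_1 -natrM qbinom1 // natrB ?natrX //.
  by rewrite expn_gt0 ltnW.
have Nn := qb n (ltnW (ltnW n2)).
have Nn2 : (Q - 1) * (qbinom q (n - 2) 1)%:R = Q ^+ (n - 2) - 1 by apply: qb; lia.
have Qn : Q ^+ n = Q ^+ 2 * Q ^+ (n - 2) by rewrite -exprD subnKC // ltnW.
(* The disjointness count is turned into a degree sum along [l]; the factor [Q - 1] clears the
   Gaussian binomials. *)
have disjE l : is_affine_space 1 l ->
  (#|[set m in L | [disjoint m & l]]| = ((q ^ 2 * qbinom q (n - 2) 1 + 1) * (x - (l \in L)))%N)
   <-> (Q - 1) * \sum_(p in l) (degree L p)%:R =
       (Q ^+ n - Q) * (l \in L)%:R + (Q - 1) * Q * x%:R.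
  move=> hl; have := sum_degree_line hL hl.
  move/(congr1 (fun m : nat => m%:R : Rdefinitions.R)).
  rewrite !natrD natr_sum cL !natrM q_1.
  (* Positivity of [x] makes the natural subtraction a true one. *)
  have lx : ((l \in L) <= x)%N by case: (_ \in _).
  set D := #|_|; set S := \sum_(p in l) _ => e.
  have eD : D%:R = x%:R * (qbinom q n 1)%:R + (Q - 1) * (l \in L)%:R - S.
    by rewrite -e addrC addKr.
  have -> : (D = (q ^ 2 * qbinom q (n - 2) 1 + 1) * (x - (l \in L)))%N <->
     (Q - 1) * D%:R = (Q - 1) * ((Q ^+ 2 * (qbinom q (n - 2) 1)%:R + 1) * (x%:R - (l \in L)%:R)).
    have -> : (Q ^+ 2 * (qbinom q (n - 2) 1)%:R + 1) * (x%:R - (l \in L)%:R)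
        = ((q ^ 2 * qbinom q (n - 2) 1 + 1) * (x - (l \in L)))%N%:R :> Rdefinitions.R.
      by rewrite natrM natrB // natrD natrM natrX.
    by split=> [->//|/(mulfI Q1)/eqP]; rewrite eqr_nat => /eqP.
  have -> : (Q - 1) * D%:R = x%:R * (Q ^+ n - 1) + (Q - 1) ^+ 2 * (l \in L)%:R - (Q - 1) * S.
    by rewrite eD -Nn; ring.
  have -> : (Q - 1) * ((Q ^+ 2 * (qbinom q (n - 2) 1)%:R + 1) * (x%:R - (l \in L)%:R))
      = (Q ^+ n - Q ^+ 2 + (Q - 1)) * (x%:R - (l \in L)%:R).
    transitivity ((Q ^+ 2 * ((Q - 1) * (qbinom q (n - 2) 1)%:R) + (Q - 1)) * (x%:R - (l \in L)%:R)).
      by ring.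
    by rewrite Nn2 Qn; ring.
  move: (Q ^+ n) => P.
  by split=> h; lra.
split=> [CL|[h _]]; last first.
  (* These weights come from solving [weighted_degree] for [c p] with total weight [x]. *)
  exists (fun p => (Q - 1) / (Q ^+ n - Q) * ((degree L p)%:R - x%:R)) => l hl.
  have /disjE-/(_ hl) e := h l hl.
  rewrite -mulr_sumr sumrB sumr_const (card_affine hl) expn1 -mulr_natl -/Q.
  have Qn0 : Q ^+ n - Q != 0.
    by rewrite subr_eq0 /Q -natrX eqr_nat -[X in _ != X]expn1 eqn_exp2l //; lia.
  by rewrite mulrAC mulrBr e; field.
have sp := (cameron_liebler_spread (ltnW n2) hL cL).1 CL.
case: CL => c hc; split=> [l hl|P [d d0 ->]].
  apply/(disjE l hl).2.
  rewrite mulr_sumr (eq_bigr _ (fun p _ => weighted_degree p hL hc)).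
  rewrite big_split -mulr_sumr -hc //= sumr_const (card_affine hl) expn1.
  (* The total weight is read off from any spread, since it covers all points and meets [L] in [x]
     lines. *)
  have -> : \sum_r c r = x%:R.
    case/affineP: (hl) => v [W [rW _]]; have sW := spread_parallel rW.
    rewrite -(sp _ sW) (weights_partial_spread hc sW.1).
    by apply: eq_bigl => r; rewrite (cover_spread sW) inE.
  by rewrite -[_ *+ q]mulr_natr -/Q; ring.
(* The affine lines through the point at infinity of [d] form a parallel class, hence a spread. *)
rewrite -(sp (cosets d setT)); last by apply: spread_parallel; rewrite rank_rV d0.
have dP : [set a *: d | a : F] = flat d 0.
  apply/setP=> p; rewrite mem_flat subr0; apply/imsetP/sub_rVP => [[a _ ->]|[a ->]]; by exists a.
congr #|pred_of_set _|; apply/setP=> m; rewrite dP !inE; apply: andb_id2l => /hL.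
case/affineP=> v [W [rW ->]]; rewrite direction_flat; apply/eqP/imsetP => [e|[p _ e]].
  exists v => //; apply: flat_eqmx; apply/eqmxP.
  by rewrite (flat_submx e) (flat_submx (esym e)).
apply: flat_eqmx; apply/eqmxP.
by rewrite (flat_submx e) (flat_submx (esym e)).
Qed.

End Lines.

Theorem theorem3p7 (F : finFieldType) (q k n x : nat)
  (hq : #|F| = q) (hk : 1 <= k) (hn : 2 * k + 1 <= n)
  (L : {set {set 'rV[F]_n}})
  (hL : set_of_kspaces k L)
  (hx : 0 < x) (hcard : #|L| = x * qbinom q n k) :
  (cameron_liebler k L <->
     (forall S, spread k S -> #|L :&: S| = x)) /\
  (cameron_liebler k L <->
     (forall R1 R2, conjugated_switching k R1 R2 -> #|L :&: R1| = #|L :&: R2|)) /\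
  (k = 1 ->
   (cameron_liebler k L <->
     ((forall l, is_affine_space 1 l ->
         #|[set m in L | [disjoint m & l]]|
           = (q ^ 2 * qbinom q (n - 2) 1 + 1) * (x - (l \in L)))
      /\ (forall P, point_at_infinity P ->
            #|[set m in L | direction m == P]| = x)))).
Proof.
have kn : k < n by rewrite (leq_trans _ hn) // mul2n -addnn addn1 ltnS leq_addr.
rewrite -hq in hcard *.
split; first exact: cameron_liebler_spread.
split; first exact: cameron_liebler_conjugated.
move=> k1; rewrite k1 in hL hcard hn *.
exact: cameron_liebler_lines.
Qed.
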